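(* Consider the linear wave equation with periodic boundary conditions $$\phi_{tt}-\phi_{xx}=0,\quad \phi(t,0)=\phi(t,2\pi),\quad \phi_x(t,0)=\phi_x(t,2\pi),\quad \phi(0,x)=\phi_0(x),\ \phi_t(0,x)=\phi_1(x),\ x\in[0,2\pi].$$ If the boundary observation is only $\phi(t,0)$ (respectively, only $\phi_x(t,0)$), exact boundary observability cannot be realized on any time interval $[0,T]$, $T>0$: for every $T>0$ there exist initial data $(\phi_0,\phi_1)$, not identically zero, and a solution of this problem such that $\phi(t,0)\equiv0$ (respectively, $\phi_x(t,0)\equiv0$) on $[0,T]$. *)

(* Defs.v *)
From Stdlib Require Import Reals.
From Coquelicot Require Import Coquelicot.
Open Scope R_scope.

Definition is_time (t : R) : Prop := 0 <= t.
Definition in_period (x : R) : Prop := 0 <= x <= 2 * PI.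
Definition strip (p : R * R) : Prop := is_time (fst p) /\ in_period (snd p).

(* [is_derive] relativised to a domain: the one-sided derivative at an
   endpoint of [D], the ordinary one at an interior point. *)
Definition is_derive_within (D : R -> Prop) (f : R -> R) (x l : R) : Prop :=
  filterdiff f (within D (locally x)) (fun y => scal y l).

Definition is_C1_strip (f ft fx : R -> R -> R) : Prop :=
  (forall t x, is_time t -> in_period x ->
     is_derive_within is_time (fun s => f s x) t (ft t x) /\
     is_derive_within in_period (fun y => f t y) x (fx t x)) /\
  continuous_on strip (fun p => f (fst p) (snd p)) /\
  continuous_on strip (fun p => ft (fst p) (snd p)) /\
  continuous_on strip (fun p => fx (fst p) (snd p)).

(* C^2 functions of (t, x) on [0, +oo) x [0, 2 PI], bundled with their partial
   derivatives; [d_tx] is the x-derivative of [d_t] and [d_xt] the t-derivative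
   of [d_x]. Values outside the strip are irrelevant. *)
Record C2_strip : Type := {
  val :> R -> R -> R;
  d_t : R -> R -> R;
  d_x : R -> R -> R;
  d_tt : R -> R -> R;
  d_tx : R -> R -> R;
  d_xt : R -> R -> R;
  d_xx : R -> R -> R;
  C1_val : is_C1_strip val d_t d_x;
  C1_d_t : is_C1_strip d_t d_tt d_tx;
  C1_d_x : is_C1_strip d_x d_xt d_xx
}.

Definition is_wave_solution (phi0 phi1 : R -> R) (phi : C2_strip) : Prop :=
  (forall t x, is_time t -> in_period x -> d_tt phi t x - d_xx phi t x = 0) /\
  (forall t, is_time t -> phi t 0 = phi t (2 * PI)) /\
  (forall t, is_time t -> d_x phi t 0 = d_x phi t (2 * PI)) /\
  (forall x, in_period x -> phi 0 x = phi0 x) /\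
  (forall x, in_period x -> d_t phi 0 x = phi1 x).

Definition obs_value (phi : C2_strip) (t : R) : R := phi t 0.
Definition obs_slope (phi : C2_strip) (t : R) : R := d_x phi t 0.

(* The observation on [0, T] uniquely determines the initial data. By linearity
   this is implied by any observability inequality bounding a norm of the data
   by a norm of the observation, so its negation rules those out as well. *)
Definition exactly_observable (obs : C2_strip -> R -> R) (T : R) : Prop :=
  forall (phi0 phi1 psi0 psi1 : R -> R) (phi psi : C2_strip),
    is_wave_solution phi0 phi1 phi ->
    is_wave_solution psi0 psi1 psi ->
    (forall t, 0 <= t <= T -> obs phi t = obs psi t) ->
    forall x, in_period x -> phi0 x = psi0 x /\ phi1 x = psi1 x.

(* Main.v *)
Require Import Defs.
From Stdlib Require Import Reals Lra.
From Coquelicot Require Import Coquelicot.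
Open Scope R_scope.

(** The standing waves [cos t * (a cos x + b sin x)] are [2 PI]-periodic
    solutions of the wave equation, for all amplitudes [a] and [b]. At [x = 0]
    their value is [a cos t] and their slope is [b cos t], so the pure sine mode
    ([standing_wave 0 1]) is invisible to the value observation, the pure cosine
    mode ([standing_wave 1 0]) to the slope observation, and this at all times.
    Both have nonzero data, whereas [standing_wave 0 0] vanishes identically and
    yields the same zero observation: the data are not determined. *)

(** The domination condition in [filterdiff] is demanded at every limit point of
    the filter, so a two-sided derivative restricts to [D] once [x] is known to
    be the only limit of the trace of its neighbourhoods on [D]. *)
Lemma is_derive_within_of_is_derive (D : R -> Prop) (f : R -> R) (x l : R) :
  D x -> is_derive f x l -> is_derive_within D f x l.
Proof.
  intros Dx [Hlin Hdom]; split; [exact Hlin|].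
  intros y Hy.
  assert (Proper : ProperFilter (within D (locally x))).
  { split; [|apply within_filter, locally_filter].
    intros P HP. exists x. exact (locally_singleton _ _ HP Dx). }
  assert (Hx : is_filter_lim (within D (locally x)) x).
  { intros P HP. exact (filter_le_within D P HP). }
  rewrite (is_filter_lim_unique y x Hy Hx).
  intros eps.
  apply filter_le_within.
  exact (Hdom x (fun P HP => HP) eps).
Qed.

Lemma continuous_on_prod (D : R * R -> Prop) (u v : R -> R) :
  (forall t, continuous u t) -> (forall x, continuous v x) ->
  continuous_on D (fun p => u (fst p) * v (snd p)).
Proof.
  intros Hu Hv. apply continuous_on_forall. intros [t x] _.
  apply (continuous_mult (K := R_AbsRing)
           (fun p : R * R => u (fst p)) (fun p => v (snd p))).
  - apply (continuous_comp (fun p : R * R => fst p) u).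
    + apply continuous_fst.
    + apply Hu.
  - apply (continuous_comp (fun p : R * R => snd p) v).
    + apply continuous_snd.
    + apply Hv.
Qed.

Lemma is_C1_strip_prod (u u' v v' : R -> R) :
  (forall t, is_derive u t (u' t)) -> (forall x, is_derive v x (v' x)) ->
  (forall t, continuous u' t) -> (forall x, continuous v' x) ->
  is_C1_strip (fun t x => u t * v x) (fun t x => u' t * v x)
    (fun t x => u t * v' x).
Proof.
  intros Du Dv Cu' Cv'.
  assert (Cu : forall t, continuous u t).
  { intros t. apply (ex_derive_continuous u). exists (u' t). apply Du. }
  assert (Cv : forall x, continuous v x).
  { intros x. apply (ex_derive_continuous v). exists (v' x). apply Dv. }
  split.
  - intros t x Ht Hx. split; apply is_derive_within_of_is_derive; trivial.
    + exact (is_derive_scal_l u t (u' t) (v x) (Du t)).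
    + exact (is_derive_scal v x (u t) (v' x) (Dv x)).
  - split; [|split]; apply continuous_on_prod; assumption.
Qed.

Definition mode (a b x : R) : R := a * cos x + b * sin x.

(** Differentiation rotates the amplitudes of a mode by a quarter turn. *)
Lemma is_derive_mode (a b x : R) : is_derive (mode a b) x (mode b (- a) x).
Proof. unfold mode. auto_derive; [exact I|ring]. Qed.

Lemma continuous_mode (a b x : R) : continuous (mode a b) x.
Proof.
  apply (ex_derive_continuous (mode a b)).
  exists (mode b (- a) x). apply is_derive_mode.
Qed.

Lemma mode_2PI (a b : R) : mode a b (2 * PI) = mode a b 0.
Proof. unfold mode. rewrite cos_2PI, sin_2PI, cos_0, sin_0. reflexivity. Qed.

Lemma mode_0 (a b : R) : mode a b 0 = a.
Proof. unfold mode. rewrite cos_0, sin_0. ring. Qed.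

Lemma is_C1_strip_mode (a b c d : R) :
  is_C1_strip (fun t x => mode a b t * mode c d x)
    (fun t x => mode b (- a) t * mode c d x)
    (fun t x => mode a b t * mode d (- c) x).
Proof.
  apply is_C1_strip_prod; intros; apply is_derive_mode || apply continuous_mode.
Qed.

(** The time factor is [mode 1 0], that is [cos], so that its derivatives obey
    the same rule as those of the space factor. *)
Definition standing_wave (a b : R) : C2_strip :=
  {| C1_val := is_C1_strip_mode 1 0 a b;
     C1_d_t := is_C1_strip_mode 0 (- 1) a b;
     C1_d_x := is_C1_strip_mode 1 0 b (- a) |}.

Lemma standing_wave_solution (a b : R) :
  is_wave_solution (mode a b) (fun _ => 0) (standing_wave a b).
Proof.
  unfold is_wave_solution; simpl. repeat split; intros.
  - unfold mode. ring.
  - rewrite mode_2PI. reflexivity.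
  - rewrite mode_2PI. reflexivity.
  - rewrite mode_0. ring.
  - rewrite mode_0. ring.
Qed.

Lemma obs_value_standing_wave (a b t : R) :
  obs_value (standing_wave a b) t = a * cos t.
Proof. unfold obs_value; simpl. rewrite mode_0. unfold mode. ring. Qed.

Lemma obs_slope_standing_wave (a b t : R) :
  obs_slope (standing_wave a b) t = b * cos t.
Proof. unfold obs_slope; simpl. rewrite mode_0. unfold mode. ring. Qed.

Lemma mode_nonzero (a b : R) :
  a <> 0 \/ b <> 0 -> exists x, in_period x /\ mode a b x <> 0.
Proof.
  pose proof PI_RGT_0. unfold in_period.
  intros [Ha|Hb].
  - exists 0. split; [lra|]. rewrite mode_0. exact Ha.
  - exists (PI / 2). split; [lra|].
    unfold mode. rewrite cos_PI2, sin_PI2. lra.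
Qed.

(** The zero wave serves as the second solution with the same observation. *)
Lemma unobservable_of_standing_wave (obs : C2_strip -> R -> R) (T a b : R) :
  a <> 0 \/ b <> 0 ->
  (forall t, obs (standing_wave a b) t = 0) ->
  (forall t, obs (standing_wave 0 0) t = 0) ->
  ~ exactly_observable obs T /\
  exists (phi0 phi1 : R -> R) (phi : C2_strip),
    ~ (forall x, in_period x -> phi0 x = 0 /\ phi1 x = 0) /\
    is_wave_solution phi0 phi1 phi /\
    (forall t, 0 <= t <= T -> obs phi t = 0).
Proof.
  intros Hab Hobs Hobs0.
  destruct (mode_nonzero a b Hab) as [x [Hx Hne]].
  split.
  - intros Huniq. apply Hne.
    destruct (Huniq _ _ _ _ _ _ (standing_wave_solution a b)
                (standing_wave_solution 0 0)) with (x := x) as [E _].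
    + intros t _. rewrite Hobs, Hobs0. reflexivity.
    + exact Hx.
    + rewrite E. unfold mode. ring.
  - exists (mode a b), (fun _ => 0), (standing_wave a b).
    split; [|split].
    + intros Hzero. apply Hne, Hzero, Hx.
    + apply standing_wave_solution.
    + intros t _. apply Hobs.
Qed.

Theorem mainTheorem11 (T : R) (hT : 0 < T) :
  (~ exactly_observable obs_value T /\
   exists (phi0 phi1 : R -> R) (phi : C2_strip),
     ~ (forall x, in_period x -> phi0 x = 0 /\ phi1 x = 0) /\
     is_wave_solution phi0 phi1 phi /\
     (forall t, 0 <= t <= T -> obs_value phi t = 0)) /\
  (~ exactly_observable obs_slope T /\
   exists (phi0 phi1 : R -> R) (phi : C2_strip),
     ~ (forall x, in_period x -> phi0 x = 0 /\ phi1 x = 0) /\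
     is_wave_solution phi0 phi1 phi /\
     (forall t, 0 <= t <= T -> obs_slope phi t = 0)).
Proof.
  split.
  - apply (unobservable_of_standing_wave obs_value T 0 1).
    + right. exact R1_neq_R0.
    + intros t. rewrite obs_value_standing_wave. ring.
    + intros t. rewrite obs_value_standing_wave. ring.
  - apply (unobservable_of_standing_wave obs_slope T 1 0).
    + left. exact R1_neq_R0.
    + intros t. rewrite obs_slope_standing_wave. ring.
    + intros t. rewrite obs_slope_standing_wave. ring.
Qed.
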